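(* Let $D\ge 1$ be a square-free integer, $r>0$ a real number, and let $Q$, $\mathrm{O}(Q)$ and $C_D(r)$ be as in the context. Let $G\subset \mathrm{O}(Q)$ be a finite subgroup and let $X\subset C_D(r)$ be a non-empty finite $G$-invariant subset. Then the following conditions are equivalent: (i) $X$ is an ellipsoidal $n$-design, i.e. $\frac{1}{\#X}\sum_{(x,y)\in X} f(x,y)=I_{D,r}(f)$ for all $f\in\mathbb{R}[x,y]$ with $\deg f\le n$; (ii) $\frac{1}{\#X}\sum_{(x,y)\in X} f(x,y)=I_{D,r}(f)$ for all $G$-invariant $f\in\mathbb{R}[x,y]$ with $\deg f\le n$.
   Context: For square-free $D\ge1$ and $r>0$: if $D\equiv 1,2 \pmod 4$, $C_D(r)=\{(x,y)\in\mathbb{R}^2: x^2+Dy^2=r\}$ and $Q=\begin{pmatrix}1&0\\0&D\end{pmatrix}$; if $D\equiv3\pmod 4$, $C_D(r)=\{(x,y)\in\mathbb{R}^2: x^2+xy+\frac{1+D}{4}y^2=r\}$ and $Q=\begin{pmatrix}1&1/2\\1/2&(1+D)/4\end{pmatrix}$. With $s$ the arc-length parameter on $C_D(r)$, the measure $d\tau$ is $d\tau=ds/\sqrt{x^2/D^2+y^2}$ for $D\equiv1,2\pmod4$ and $d\tau=ds/\sqrt{20x^2+(D^2+2D+5)y^2+(20+4D)xy}$ for $D\equiv 3\pmod 4$. The normalized integral is $I_{D,r}(f)=\frac{1}{2\pi\sqrt D}\int_{C_D(r)}f\,d\tau$ for $D\equiv1,2\pmod4$ and $I_{D,r}(f)=\frac{\sqrt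 D}{\pi}\int_{C_D(r)}f\,d\tau$ for $D\equiv3\pmod4$. Equivalently, $I_{D,r}(f)=\frac1{2\pi}\int_0^{2\pi}f(x(\theta),y(\theta))\,d\theta$, where $(x(\theta),y(\theta))=(\sqrt r\cos\theta,\sqrt r\sin\theta/\sqrt D)$ for $D\equiv1,2\pmod 4$ and $(x(\theta),y(\theta))=(\sqrt r(\cos\theta-\sin\theta/\sqrt D),\,2\sqrt r\sin\theta/\sqrt D)$ for $D\equiv3\pmod4$. $\mathrm{O}(Q)=\{A\in \mathrm{GL}_2(\mathbb{R}): {}^tAQA=Q\}$, acting on $\mathbb{R}^2$ (column vectors) by matrix multiplication; it preserves $C_D(r)$. A matrix $M\in G$ acts on polynomials by $f^M(x,y)=f((x,y)\cdot{}^t(M^{-1}))$; $f$ is $G$-invariant if $f^M=f$ for all $M\in G$. $X$ is $G$-invariant if $MX=X$ for all $M\in G$. *)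

(* Defs.v *)
From HB Require Import structures.
From mathcomp Require Import all_boot all_order all_algebra.
From mathcomp Require Import finmap.
From mathcomp Require Import all_classical all_reals all_analysis.
(* [mpoly]'s notations clash with those of mathcomp-analysis. *)
From mathcomp Require Import -(notations) mpoly.

Set Implicit Arguments.
Unset Strict Implicit.
Unset Printing Implicit Defensive.

Import Order.TTheory GRing.Theory Num.Theory.
Import numFieldNormedType.Exports.

Local Open Scope classical_set_scope.
Local Open Scope ring_scope.

Definition square_free (D : nat) : Prop :=
  forall d : nat, (d ^ 2 %| D)%N -> d = 1%N.

Section Conic.
Variables (R : realType) (D : nat) (r : R).

Local Notation d := (D%:R : R).

(* A point (x, y) of the plane is a column vector. *)
Definition px (v : 'cV[R]_2) : R := v ord0 ord0.
Definition py (v : 'cV[R]_2) : R := v ord_max ord0.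
Definition pt (x y : R) : 'cV[R]_2 := \col_(i < 2) (if i == ord0 then x else y).

Definition mx2 (a b c e : R) : 'M[R]_2 :=
  \matrix_(i < 2, j < 2)
    if i == ord0 then (if j == ord0 then a else b)
    else (if j == ord0 then c else e).

(* A square-free D is never 0 mod 4, so in each definition below the second
   branch is the case D = 1, 2 mod 4. *)
Definition Qmx : 'M[R]_2 :=
  if (D %% 4 == 3)%N then mx2 1 (1 / 2) (1 / 2) ((1 + d) / 4)
  else mx2 1 0 0 d.

Definition conic : set 'cV[R]_2 :=
  if (D %% 4 == 3)%N then
    [set v | px v ^+ 2 + px v * py v + (1 + d) / 4 * py v ^+ 2 = r]
  else [set v | px v ^+ 2 + d * py v ^+ 2 = r].

Definition conic_param (t : R) : 'cV[R]_2 :=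
  if (D %% 4 == 3)%N then
    pt (Num.sqrt r * (cos t - sin t / Num.sqrt d))
       (2 * Num.sqrt r * sin t / Num.sqrt d)
  else pt (Num.sqrt r * cos t) (Num.sqrt r * sin t / Num.sqrt d).

(* ds / dt *)
Definition speed (gamma : R -> 'cV[R]_2) (t : R) : R :=
  Num.sqrt (derive1 (px \o gamma) t ^+ 2 + derive1 (py \o gamma) t ^+ 2).

Definition arc_length_integral (gamma : R -> 'cV[R]_2) (a b : R)
    (h : 'cV[R]_2 -> R) : R :=
  \int[lebesgue_measure]_(t in `[a, b]) (h (gamma t) * speed gamma t).

Definition tau_density (v : 'cV[R]_2) : R :=
  if (D %% 4 == 3)%N then
    (Num.sqrt (20 * px v ^+ 2 + (d ^+ 2 + 2 * d + 5) * py v ^+ 2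
               + (20 + 4 * d) * px v * py v))^-1
  else (Num.sqrt (px v ^+ 2 / d ^+ 2 + py v ^+ 2))^-1.

Definition tau_integral (h : 'cV[R]_2 -> R) : R :=
  arc_length_integral conic_param 0 (2 * pi) (fun v => h v * tau_density v).

Definition normalized_integral (h : 'cV[R]_2 -> R) : R :=
  if (D %% 4 == 3)%N then Num.sqrt d / pi * tau_integral h
  else (2 * pi * Num.sqrt d)^-1 * tau_integral h.

End Conic.

Definition orthogonal_group (R : realType) (Q : 'M[R]_2) : set 'M[R]_2 :=
  [set A | A \in unitmx /\ A^T *m Q *m A = Q].

Definition is_subgroup (R : realType) (G : {fset 'M[R]_2}) (H : set 'M[R]_2)
    : Prop :=
  [/\ [set` G] `<=` H, 1%:M \in G,
      forall A B, A \in G -> B \in G -> A *m B \in G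
    & forall A, A \in G -> invmx A \in G].

Definition set_invariant (R : realType) (G : {fset 'M[R]_2})
    (X : {fset 'cV[R]_2}) : Prop :=
  forall M, M \in G -> [fset M *m v | v in X]%fset = X.

Definition peval (R : realType) (f : mpoly 2 R) (v : 'cV[R]_2) : R :=
  meval (fun i => v i ord0) f.

(* f^M : the row vector (x, y) *m (M^-1)^T has i-th entry
   \sum_j (M^-1)_(i, j) 'X_j. *)
Definition poly_act (R : realType) (M : 'M[R]_2) (f : mpoly 2 R) : mpoly 2 R :=
  comp_mpoly
    [tuple \sum_(j < 2) invmx M i j *: (@mpolyX 2 R (mnm1 j)) | i < 2] f.

Definition poly_invariant (R : realType) (G : {fset 'M[R]_2})
    (f : mpoly 2 R) : Prop :=
  forall M, M \in G -> poly_act M f = f.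

Definition average (R : realType) (X : {fset 'cV[R]_2}) (h : 'cV[R]_2 -> R)
    : R :=
  (#|` X|%:R)^-1 * \sum_(v <- X) h v.

(* [msize f <= n.+1] is [deg f <= n]. *)
Definition ellipsoidal_design (R : realType) (D : nat) (r : R) (n : nat)
    (X : {fset 'cV[R]_2}) : Prop :=
  forall f : mpoly 2 R, (msize f <= n.+1)%N ->
    average X (peval f) = normalized_integral D r (peval f).

(* Main.v *)
Require Import Defs.
From HB Require Import structures.
From mathcomp Require Import all_boot all_order all_algebra.
From mathcomp Require Import finmap.
From mathcomp Require Import all_classical all_reals all_analysis.
From mathcomp Require Import -(notations) mpoly.
From mathcomp Require Import ring lra zify.

(* Averaging f over G gives a G-invariant polynomial of no larger degree. The
   average over X does not see the difference, as X is G-invariant. Neither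
   does the normalized integral: it is (2 pi)^-1 times the integral of f over
   the angular parameter of the conic, and an element of O(Q) acts on this
   parameter by t |-> +t + c or t |-> -t + c, which preserves integrals of
   2 pi-periodic functions over a period. *)

Import Order.TTheory GRing.Theory Num.Theory.
Import numFieldNormedType.Exports.

Local Open Scope classical_set_scope.
Local Open Scope ring_scope.

(** * Linear substitutions in polynomials: degree, evaluation, composition *)

Section PolynomialAction.
Variable R : realType.
Implicit Types (f g : mpoly 2 R) (M N : 'M[R]_2).

(** [msize] is the degree plus one, so [a] and [b] bound degrees, which add up. Zero factors have
    [msize] 0 and are split off because the product formula requires non-zero factors. *)
Lemma msizeM_leD n (p q : mpoly n R) (a b : nat) :
  (msize p <= a.+1)%N -> (msize q <= b.+1)%N -> (msize (p * q) <= (a + b).+1)%N.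
Proof.
move=> hp hq.
have [->|p0] := eqVneq p 0; first by rewrite mul0r msize0.
have [->|q0] := eqVneq q 0; first by rewrite mulr0 msize0.
rewrite msizeM//; move: (msize p) (msize q) hp hq => i j hi hj; lia.
Qed.

Lemma msizeX_leM n (p : mpoly n R) (k : nat) :
  (msize p <= 2)%N -> (msize (p ^+ k) <= k.+1)%N.
Proof.
move=> hp; elim: k => [|k IH]; first by rewrite expr0 msize1.
by rewrite exprS; exact: (@msizeM_leD _ _ _ 1 k).
Qed.

(** Each monomial of [p] becomes a product of powers of polynomials of degree at most 1, whose
    degree is at most that of the monomial. *)
Lemma msize_comp_linear n k (lq : n.-tuple (mpoly k R)) (p : mpoly n R) :
  (forall i, msize (tnth lq i) <= 2)%N -> (msize (comp_mpoly lq p) <= msize p)%N.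
Proof.
move=> hlq; rewrite comp_mpolyEX; apply: (leq_trans (msize_sum _ _ _)).
apply/bigmax_leqP_seq => m mp _; apply: (leq_trans (msizeZ_le _ _)).
apply: leq_trans (msize_mdeg_lt mp); rewrite comp_mpolyX mdegE.
elim/big_rec2: _ => [|i a q _ IH]; first by rewrite msize1.
by apply: msizeM_leD => //; exact: msizeX_leM.
Qed.

Lemma msize_poly_act M f : (msize (poly_act M f) <= msize f)%N.
Proof.
apply: msize_comp_linear => i; rewrite tnth_mktuple.
apply: (leq_trans (msize_sum _ _ _)); apply/bigmax_leqP => j _.
by apply: (leq_trans (msizeZ_le _ _)); rewrite msizeX mdeg1.
Qed.

Lemma peval_poly_act M f v : peval (poly_act M f) v = peval f (invmx M *m v).
Proof.
rewrite /peval /poly_act comp_mpoly_meval; apply: meval_eq => i.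
rewrite tnth_mktuple raddf_sum mxE; apply: eq_bigr => j _.
by rewrite /= mevalZ mevalXU.
Qed.

Lemma poly_actX M i :
  poly_act M (@mpolyX 2 R (mnm1 i)) =
  \sum_(j < 2) invmx M i j *: @mpolyX 2 R (mnm1 j).
Proof. by rewrite /poly_act comp_mpolyXU -tnth_nth tnth_mktuple. Qed.

Lemma poly_actP M c f g :
  poly_act M (c *: f + g) = c *: poly_act M f + poly_act M g.
Proof. by rewrite [LHS]linearP. Qed.

Lemma poly_act_monomial M (m : multinom 2) :
  poly_act M (@mpolyX 2 R m) =
  \prod_(i < 2) poly_act M (@mpolyX 2 R (mnm1 i)) ^+ m i.
Proof.
rewrite [LHS]comp_mpolyX; apply: eq_bigr => i _.
by rewrite poly_actX tnth_mktuple.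
Qed.

(** The inverse in the action undoes the reversal of order caused by substitution, so this is a left
    action. Both sides are algebra morphisms in [f]: on variables the claim is the product formula
    for [invmx N *m invmx M], and it extends to monomials and then to sums of terms. *)
Lemma poly_actM M N f : M \in unitmx -> N \in unitmx ->
  poly_act M (poly_act N f) = poly_act (M *m N) f.
Proof.
move=> uM uN.
have invMN : invmx (M *m N) = invmx N *m invmx M.
  apply: (can_inj (mulKmx (_ : M *m N \in unitmx))).
    by rewrite unitmx_mul uM.
  by rewrite mulmxV ?unitmx_mul ?uM// -mulmxA (mulmxA N) mulmxV// mul1mx mulmxV.
have actX i : poly_act M (poly_act N (@mpolyX 2 R (mnm1 i))) =
    poly_act (M *m N) (@mpolyX 2 R (mnm1 i)).
  rewrite poly_actX [LHS]raddf_sum poly_actX invMN.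
  under eq_bigr do rewrite /= comp_mpolyZ -/(poly_act _ _) poly_actX scaler_sumr.
  rewrite exchange_big/=; apply: eq_bigr => j _.
  under eq_bigr do rewrite scalerA.
  by rewrite -scaler_suml mxE.
elim/mpolyind: f => [|c m p _ _ IH]; first by rewrite /poly_act !raddf0.
pose X := @mpolyX 2 R m.
apply: (etrans (congr1 (poly_act M) (poly_actP N c X p))).
apply: (etrans (poly_actP M c (poly_act N X) (poly_act N p))).
apply: (etrans _ (esym (poly_actP (M *m N) c X p))).
apply: (f_equal2 (fun a b => c *: a + b) _ IH).
apply: (etrans (congr1 (poly_act M) (poly_act_monomial N m))).
apply: (etrans _ (esym (poly_act_monomial (M *m N) m))).
rewrite [LHS]rmorph_prod; apply: eq_bigr => i _.
by rewrite -actX; exact: rmorphXn.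
Qed.

End PolynomialAction.

(** * Sums over the finite group and averages over an invariant set *)

Section GroupAverage.
Variables (R : realType) (Q : 'M[R]_2) (G : {fset 'M[R]_2}).
Hypothesis hG : is_subgroup G (orthogonal_group Q).

Lemma subgroup_unitmx M : M \in G -> M \in unitmx.
Proof. by case: hG => sG _ _ _ /sG[]. Qed.

Lemma subgroup_translate M : M \in G -> [fset M *m N | N in G]%fset = G.
Proof.
case: hG => _ _ mG iG MG; apply/fsetP => K; apply/imfsetP/idP.
  by case=> N NG ->; exact: mG.
move=> KG; exists (invmx M *m K); first by apply: mG => //; exact: iG.
by rewrite mulKVmx// subgroup_unitmx.
Qed.

(** Acting by [M] turns the index [N] into [M *m N], and left translation permutes [G]. The sum is
    not divided by the order of [G]: only the vanishing of an additive functional on it will be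
    used. *)
Lemma orbit_sum_invariant (f : mpoly 2 R) :
  poly_invariant G (\sum_(N <- G) poly_act N f).
Proof.
move=> M MG; rewrite /poly_act raddf_sum -/(poly_act _ _)/=.
rewrite -[in RHS](subgroup_translate _ MG) big_imfset/=; last first.
  by move=> A B _ _; apply: can_inj (mulKmx _) _ _; exact: subgroup_unitmx.
apply: eq_big_seq => N NG.
by rewrite -!/(poly_act _ _) poly_actM//; exact: subgroup_unitmx.
Qed.

(** The acted polynomial takes at [v] the value of [f] at [invmx M *m v], and [invmx M], being in
    [G], permutes [X]. *)
Lemma average_peval_act (X : {fset 'cV[R]_2}) M f :
  set_invariant G X -> M \in G ->
  average X (peval (poly_act M f)) = average X (peval f).
Proof.
case: hG => _ _ _ iG hX MG; rewrite /average; congr (_ * _).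
rewrite -[in RHS](hX _ (iG _ MG)) big_imfset/=.
  by apply: eq_bigr => v _; rewrite peval_poly_act.
by move=> A B _ _; apply: can_inj (mulKVmx _) _ _; exact: subgroup_unitmx.
Qed.

End GroupAverage.

(** * Integrals of periodic functions over a period *)

Section PeriodicIntegral.
Variable R : realType.
Notation mu := (@lebesgue_measure R).
Implicit Types F A : R -> R.

Lemma continuous_itv_integrable F (a b : R) : continuous F ->
  mu.-integrable `[a, b] (EFin \o F).
Proof.
move=> cF; apply: continuous_compact_integrable; first exact: segment_compact.
exact: continuous_subspaceT.
Qed.

(** The integral from [- K] is a primitive by the fundamental theorem of calculus. A bounded window
    is enough for what follows and gives the integral a finite base point. *)
Lemma continuous_primitive F (K : R) : continuous F ->
  exists A, forall x, - K < x < K -> is_derive x (1 : R) A (F x).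
Proof.
move=> cF; exists (fun x => \int[mu]_(t in `[- K, x]) F t) => x /andP[Kx xK].
have [] := @continuous_FTC1_closed R F (- K) x K xK _ Kx (cF x).
  exact: continuous_itv_integrable.
by move=> dA; rewrite derive1E => <-; exact: DeriveDef.
Qed.

Lemma Rintegral_primitive F A (a b : R) : a < b -> continuous F ->
  (forall x, a <= x <= b -> is_derive x (1 : R) A (F x)) ->
  \int[mu]_(x in `[a, b]) F x = A b - A a.
Proof.
move=> ab cF dA.
have cA x : a <= x <= b -> {for x, continuous A}.
  move=> xab; have [dx _] := dA x xab.
  by apply: differentiable_continuous; apply/derivable1_diffP.
rewrite /Rintegral (@continuous_FTC2 _ F A)//.
- exact: continuous_subspaceT.
- split.
  + move=> x; rewrite in_itv/= => /andP[/ltW ax /ltW xb].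
    by have [] := dA x; rewrite ?ax.
  + by apply: cvg_at_right_filter; apply: cA; rewrite lexx ltW.
  + by apply: cvg_at_left_filter; apply: cA; rewrite lexx ltW.
- move=> x; rewrite in_itv/= => /andP[/ltW ax /ltW xb].
  by rewrite derive1E; apply: derive_val; apply: dA; rewrite ax.
Qed.

(* With a primitive A, both integrals are differences A (x + T) - A x, and
   such a difference does not depend on x as its derivative is
   F (x + T) - F x = 0. *)
Lemma Rintegral_periodic_isometry F (T e c : R) : 0 < T -> continuous F ->
  periodic F T -> e ^+ 2 = 1 -> `|c| <= T ->
  \int[mu]_(t in `[0, T]) F (e * t + c) = \int[mu]_(t in `[0, T]) F t.
Proof.
move=> T0 cF pF e2 cT; have [c1 c2] : - T <= c /\ c <= T.
  by move: cT; rewrite ler_norml => /andP.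
(* The factor 10 only leaves room: [B] is compared on [[-5T, 5T]], where it evaluates [A] no further
   than [6T]. *)
have [A dA] := @continuous_primitive F (10 * T) cF.
pose B x := A (x + T) - A x.
have dB x : - (10 * T) < x < 9 * T -> is_derive x (1 : R) B 0.
  move=> /andP[x1 x2].
  have d1 : is_derive x (1 : R) A (F x) by apply: dA; apply/andP; split; lra.
  have d2 : is_derive (x + T) (1 : R) A (F (x + T)).
    by apply: dA; apply/andP; split; lra.
  have d3 : is_derive x (1 : R) (A \o (fun y => y + T)) (F (x + T)).
    by apply: (is_derive_eq (is_derive1_comp _ _)); rewrite ?addr0 ?mulr1.
  rewrite (_ : 0 = F (x + T) - F x); last by rewrite pF subrr.
  exact: is_deriveB.
have cst x y : - (5 * T) <= x -> x <= y -> y <= 5 * T -> B y = B x.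
  move=> x1 xy y1.
  have dBxy z : z \in `[x, y] -> is_derive z (1 : R) B 0.
    rewrite in_itv/= => /andP[xz zy]; apply: dB; apply/andP; split; lra.
  have dBo z : z \in `]x, y[ -> is_derive z (1 : R) B 0.
    by move=> zxy; apply: dBxy; exact: subset_itv_oo_cc zxy.
  have cB : {within `[x, y], continuous B}.
    by apply: derivable_within_continuous => z /dBxy[].
  have [z _ /eqP] := MVT_segment xy dBo cB.
  by rewrite mul0r subr_eq0 => /eqP.
have B0 x : - (5 * T) <= x <= 5 * T -> B x = B 0.
  move=> /andP[x1 x2].
  by have [x0|/ltW x0] := leP 0 x; [|symmetry]; apply: cst; lra.
have e1 : e = 1 \/ e = -1.
  have /eqP : (e - 1) * (e + 1) = 0 by rewrite -subr_sqr e2 expr1n subrr.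
  by rewrite mulf_eq0 subr_eq0 addr_eq0 => /orP[]/eqP; [left|right].
have dA0 x : 0 <= x <= T -> is_derive x (1 : R) A (F x).
  by move=> /andP[x0 xT]; apply: dA; apply/andP; split; lra.
rewrite (Rintegral_primitive F A _ _ T0 cF dA0).
(* As [e ^+ 2 = 1], the outer factor [e] cancels the one from the chain rule, so [A'] is a primitive
   of the transformed integrand. *)
pose A' := e *: (A \o (fun t => e * t + c)).
have dA' x : 0 <= x <= T -> is_derive x (1 : R) A' (F (e * x + c)).
  move=> /andP[x0 xT].
  have d1 : is_derive (e * x + c) (1 : R) A (F (e * x + c)).
    by apply: dA; case: e1 => ->; apply/andP; split; lra.
  have d2 : is_derive x (1 : R) (fun t => e * t + c) e.
    by apply: is_derive_eq; rewrite /GRing.scale/= addr0 mulr1 ?mulr0 ?addr0.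
  have -> : F (e * x + c) = e *: (F (e * x + c) * e).
    by rewrite /GRing.scale/= mulrCA -expr2 e2 mulr1.
  exact: is_deriveZ.
have cF' : continuous (fun t => F (e * t + c)).
  move=> x; apply: continuous_comp; last exact: cF.
  by apply: cvgD; [apply: cvgM; [exact: cvg_cst|exact: cvg_id]|exact: cvg_cst].
rewrite (Rintegral_primitive _ A' _ _ T0 cF' dA') /A' /GRing.scale/=.
(* The left-hand side is [B c] for [e = 1] and [B (c - T)] for [e = -1]; the right-hand side is
   [B 0]. *)
case: e1 => ->; rewrite !(mulr0, add0r, mul1r, mulN1r, scale1r, scaleN1r).
  by have := B0 c; rewrite /B add0r [c + T]addrC => ->//; apply/andP; split; lra.
have := B0 (c - T); rewrite /B subrK add0r => <-; last by apply/andP; split; lra.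
by rewrite opprK addrC [- T + c]addrC.
Qed.

End PeriodicIntegral.

(** * Orthogonal 2 x 2 matrices in terms of an angle *)

Section Rotations.
Variable R : realType.

(** The angle [acos a] has the right cosine and the sine [|b|]; the sign of [b] decides between it
    and its opposite. *)
Lemma unit_circle_angle (a b : R) : a ^+ 2 + b ^+ 2 = 1 ->
  exists2 c : R, `|c| <= pi & cos c = a /\ sin c = b.
Proof.
move=> ab1.
have a1 : -1 <= a <= 1.
  rewrite -ler_norml -(expr_le1 (_ : 0 < 2)%N)// -normrX ger0_norm ?sqr_ge0//.
  by rewrite -ab1 lerDl sqr_ge0.
have ca : cos (acos a) = a by rewrite acosK// in_itv.
have sa : sin (acos a) = `|b|.
  by rewrite sin_acos// -ab1 addrAC subrr add0r sqrtr_sqr.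
have [b0|b0] := leP 0 b.
  exists (acos a); first by rewrite ger0_norm ?acos_ge0 ?acos_lepi.
  by rewrite ca sa ger0_norm.
exists (- acos a); first by rewrite normrN ger0_norm ?acos_ge0 ?acos_lepi.
by rewrite cosN sinN ca sa ltr0_norm// opprK.
Qed.

Lemma mulmx_mx2 (a b c e a' b' c' e' : R) :
  mx2 a b c e *m mx2 a' b' c' e' =
  mx2 (a * a' + b * c') (a * b' + b * e') (c * a' + e * c') (c * b' + e * e').
Proof.
apply/matrixP => i j; rewrite !mxE !big_ord_recl big_ord0 !mxE/= addr0.
by case: (i == ord0); case: (j == ord0).
Qed.

Lemma trmx_mx2 (a b c e : R) : (mx2 a b c e)^T = mx2 a c b e.
Proof.
by apply/matrixP => i j; rewrite !mxE; case: (i == ord0); case: (j == ord0).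
Qed.

Lemma mulmx_pt (a b c e x y : R) :
  mx2 a b c e *m pt x y = pt (a * x + b * y) (c * x + e * y).
Proof.
apply/matrixP => i j; rewrite !mxE !big_ord_recl big_ord0 !mxE/= addr0.
by case: (i == ord0).
Qed.

Lemma mx2_eta (U : 'M[R]_2) :
  U = mx2 (U ord0 ord0) (U ord0 ord_max) (U ord_max ord0) (U ord_max ord_max).
Proof.
apply/matrixP => i j; rewrite !mxE.
by case: i j => [[|[|//]] hi] [[|[|//]] hj]; congr (U _ _); exact: val_inj.
Qed.

Lemma scalar_mx2 (a : R) : a%:M = mx2 a 0 0 a.
Proof.
apply/matrixP => i j; rewrite !mxE.
by case: i j => [[|[|//]] hi] [[|[|//]] hj].
Qed.

Lemma mx2_inj (a b c e a' b' c' e' : R) : mx2 a b c e = mx2 a' b' c' e' ->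
  [/\ a = a', b = b', c = c' & e = e'].
Proof.
move=> /matrixP h; split.
- by have := h ord0 ord0; rewrite !mxE.
- by have := h ord0 ord_max; rewrite !mxE.
- by have := h ord_max ord0; rewrite !mxE.
- by have := h ord_max ord_max; rewrite !mxE.
Qed.

(** The first column of [U] is a unit vector, which gives [c]. The second is [s] times the first
    turned by a right angle, where [s] is the determinant, and the addition formulas conclude. *)
Lemma orthogonal_angle (U : 'M[R]_2) : U^T *m U = 1%:M ->
  exists s c : R, [/\ s ^+ 2 = 1, `|c| <= pi &
    forall t, U *m pt (cos t) (sin t) = pt (cos (s * t + c)) (sin (s * t + c))].
Proof.
rewrite (mx2_eta U) trmx_mx2 mulmx_mx2 scalar_mx2.
move: (U ord0 ord0) (U ord0 ord_max) (U ord_max ord0) (U ord_max ord_max).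
move=> x y z w /mx2_inj[h1 h2 _ h3].
have xz : x ^+ 2 + z ^+ 2 = 1 by rewrite !expr2.
have [c cpi [cx cz]] := unit_circle_angle _ _ xz.
pose s := x * w - y * z.
have s2 : s ^+ 2 = 1.
  rewrite /s.
  (* Lagrange's identity expresses the squared determinant through the inner products of the
     columns. *)
  have -> : (x * w - y * z) ^+ 2 =
    (x * x + z * z) * (y * y + w * w) - (x * y + z * w) ^+ 2 by ring.
  by rewrite h1 h2 h3; ring.
have yE : y = - s * z.
  rewrite /s; have -> : - (x * w - y * z) * z =
    y * (x * x + z * z) - x * (x * y + z * w) by ring.
  by rewrite h1 h2; ring.
have wE : w = s * x.
  rewrite /s; have -> : (x * w - y * z) * x =
    w * (x * x + z * z) - z * (x * y + z * w) by ring.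
  by rewrite h1 h2; ring.
have s1 : s = 1 \/ s = -1.
  have /eqP : (s - 1) * (s + 1) = 0 by rewrite -subr_sqr s2 expr1n subrr.
  by rewrite mulf_eq0 subr_eq0 addr_eq0 => /orP[]/eqP; [left|right].
exists s, c; split=> // t; rewrite mulmx_pt cosD sinD cx cz yE wE.
case: s1 => ->; rewrite ?mul1r ?mulN1r ?cosN ?sinN; congr pt; ring.
Qed.

End Rotations.

(** * The action of the orthogonal group of the form on the angular parameter *)

Section ConicIsometry.
Variables (R : realType) (D : nat) (r : R).
Hypotheses (hD1 : (1 <= D)%N) (hr : 0 < r).

Local Notation d := (D%:R : R).
Local Notation q := (Num.sqrt d).

(* Maps the unit circle onto the conic. *)
Definition param_mx : 'M[R]_2 :=
  if (D %% 4 == 3)%N then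
    mx2 (Num.sqrt r) (- (Num.sqrt r / q)) 0 (2 * Num.sqrt r / q)
  else mx2 (Num.sqrt r) 0 0 (Num.sqrt r / q).

Lemma param_mxE t : conic_param D r t = param_mx *m pt (cos t) (sin t).
Proof.
rewrite /conic_param /param_mx; case: ifP => _; rewrite mulmx_pt; congr pt; ring.
Qed.

(** This is the completed square: for [D] congruent to 3 mod 4 the form is
    [(x + y / 2) ^+ 2 + d * (y / 2) ^+ 2], and [param_mx] makes the two squares [r] times those of
    the coordinates. *)
Lemma param_mx_form : param_mx^T *m Qmx R D *m param_mx = r%:M.
Proof.
have d0 : 0 < d by rewrite ltr0n.
have q0 : q != 0 by rewrite gt_eqF// sqrtr_gt0.
have dE : d = q ^+ 2 by rewrite sqr_sqrtr// ltW.
have rE : r = Num.sqrt r ^+ 2 by rewrite sqr_sqrtr// ltW.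
rewrite scalar_mx2 [in RHS]rE /param_mx /Qmx.
(* With the two square roots as free letters, the entries are identities of rational functions. *)
move: q (Num.sqrt r) q0 dE => w s w0 ->.
by case: ifP => _; rewrite trmx_mx2 !mulmx_mx2; congr mx2; field.
Qed.

(** Conjugating [M] by [P] gives a matrix [U] preserving [P^T *m Q *m P], which is the scalar [r].
    Hence [U] is orthogonal and acts on the angle as a rotation or a reflection. *)
Lemma orthogonal_conic_param (M : 'M[R]_2) : orthogonal_group (Qmx R D) M ->
  exists s c : R, [/\ s ^+ 2 = 1, `|c| <= pi &
    forall t, M *m conic_param D r t = conic_param D r (s * t + c)].
Proof.
move=> [_ MQ]; set P := param_mx.
have r0 : r != 0 by rewrite gt_eqF.
have uP : P \in unitmx.
  have : r%:M \in @unitmx R 2 by rewrite unitmxE det_scalar unitfE expf_neq0.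
  by rewrite -param_mx_form unitmx_mul => /andP[].
have [U PU] : exists U, P *m U = M *m P.
  by exists (invmx P *m (M *m P)); rewrite mulKVmx.
have UU : U^T *m U = 1%:M.
  have : U^T *m r%:M *m U = r%:M.
    rewrite -param_mx_form -/P.
    have -> : U^T *m (P^T *m Qmx R D *m P) *m U =
      (P *m U)^T *m Qmx R D *m (P *m U) by rewrite trmx_mul !mulmxA.
    by rewrite PU trmx_mul -[in RHS]MQ !mulmxA.
  by rewrite mul_mx_scalar -scalemxAl -(scalemx1 _ r) => /(scalerI r0).
have [s [c [s2 cpi hU]]] := orthogonal_angle _ _ UU.
exists s, c; split=> // t.
by rewrite !param_mxE mulmxA -PU -mulmxA hU.
Qed.

End ConicIsometry.

(** * The normalized integral as a mean over the angle, and its invariance *)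

Section NormalizedIntegral.
Variables (R : realType) (D : nat) (r : R).
Hypotheses (hD1 : (1 <= D)%N) (hr : 0 < r).

Local Notation d := (D%:R : R).
Local Notation q := (Num.sqrt d).
Local Notation mu := (@lebesgue_measure R).

Lemma derive1_trig (a b t : R) :
  derive1 (fun x => a * cos x + b * sin x) t = b * cos t - a * sin t.
Proof.
have h : is_derive t (1 : R) (a *: cos + b *: sin) (a *: - sin t + b *: cos t).
  exact: is_deriveD.
by rewrite derive1E (derive_val (f := _ + _)) /GRing.scale/= mulrN addrC.
Qed.

Lemma speed_conic_param t :
  speed (conic_param D r) t = Num.sqrt (r *
    if (D %% 4 == 3)%N then (sin t + cos t / q) ^+ 2 + (2 * (cos t / q)) ^+ 2
    else sin t ^+ 2 + (cos t / q) ^+ 2).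
Proof.
have rE : r = Num.sqrt r ^+ 2 by rewrite sqr_sqrtr// ltW.
rewrite /speed /conic_param; congr Num.sqrt.
case: ifP => _.
  rewrite (_ : @px R \o _ =
    fun x => Num.sqrt r * cos x + (- (Num.sqrt r / q)) * sin x); last first.
    by apply/funext => x; rewrite /= /px mxE/=; ring.
  rewrite (_ : @py R \o _ =
    fun x => 0 * cos x + (2 * Num.sqrt r / q) * sin x); last first.
    by apply/funext => x; rewrite /= /py mxE/=; ring.
  by rewrite !derive1_trig [in RHS]rE; ring.
rewrite (_ : @px R \o _ = fun x => Num.sqrt r * cos x + 0 * sin x); last first.
  by apply/funext => x; rewrite /= /px mxE/=; ring.
rewrite (_ : @py R \o _ =
    fun x => 0 * cos x + (Num.sqrt r / q) * sin x); last first.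
  by apply/funext => x; rewrite /= /py mxE/=; ring.
by rewrite !derive1_trig [in RHS]rE; ring.
Qed.

(** Along the parametrization the quadratic form under the root of the density is a constant
    multiple of the squared speed. The measure is therefore a constant times the angular one. *)
Lemma tau_density_speed t :
  tau_density D (conic_param D r t) * speed (conic_param D r) t =
  if (D %% 4 == 3)%N then (2 * q)^-1 else q.
Proof.
have d0 : 0 < d by rewrite ltr0n.
have q0 : 0 < q by rewrite sqrtr_gt0.
have qn0 : q != 0 by rewrite gt_eqF.
have dE : q ^+ 2 = d by rewrite sqr_sqrtr// ltW.
have rE : Num.sqrt r ^+ 2 = r by rewrite sqr_sqrtr// ltW.
have cs := cos2Dsin2 t.
rewrite speed_conic_param /tau_density /conic_param; case: (_ == 3)%N.
  set u := r * _.
  (* Cancelling the root of [u] needs [u] non-zero: its two squares cannot both vanish, since sine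
     and cosine have no common zero. *)
  have u0 : 0 < u.
    rewrite mulr_gt0//; have [c0|c0] := eqVneq (cos t) 0.
      have s1 : sin t ^+ 2 = 1 by rewrite -cs c0 expr0n/= add0r.
      by rewrite c0 mul0r mulr0 addr0 s1 expr0n/= addr0.
    rewrite ltr_wpDl ?sqr_ge0//.
    by rewrite exprn_even_gt0//= !mulf_neq0// invr_eq0.
  rewrite (_ : _ + _ * px _ * py _ = (2 * q) ^+ 2 * u); last first.
    rewrite /u /px /py !mxE/= -[X in _ = _ * (X * _)]rE.
    by move: q (Num.sqrt r) qn0 dE => w s w0 <-; field.
  rewrite sqrtrM ?sqr_ge0// sqrtr_sqr gtr0_norm ?mulr_gt0//.
  by rewrite invfM -mulrA mulVf ?mulr1// gt_eqF// sqrtr_gt0.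
rewrite /px /py !mxE/=; set v := (X in (Num.sqrt X)^-1).
have v0 : 0 < v.
  have -> : v = r / d ^+ 2 * (cos t ^+ 2 + d * sin t ^+ 2).
    rewrite /v -[X in _ = X / _ * _]rE.
    by move: q (Num.sqrt r) qn0 dE => w s w0 <-; field.
  (* This form is at least 1, as [d] is at least 1. *)
  have -> : cos t ^+ 2 + d * sin t ^+ 2 = 1 + (d - 1) * sin t ^+ 2.
    have -> : cos t ^+ 2 = 1 - sin t ^+ 2 by rewrite -cs addrK.
    ring.
  rewrite mulr_gt0 ?divr_gt0 ?exprn_gt0// ltr_pwDl// mulr_ge0 ?sqr_ge0//.
  by rewrite subr_ge0 ler1n.
rewrite (_ : r * _ = q ^+ 2 * v); last first.
  rewrite /v -[X in X * _ = _]rE.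
  by move: q (Num.sqrt r) qn0 dE => w s w0 <-; field.
rewrite sqrtrM ?sqr_ge0// sqrtr_sqr gtr0_norm//.
by rewrite mulrCA mulVf ?mulr1// gt_eqF// sqrtr_gt0.
Qed.

(** The prefactors [q / pi] and [(2 * pi * q)^-1] meet the constants [(2 * q)^-1] and [q] of
    [tau_density_speed], leaving [(2 * pi)^-1] in both cases. Continuity supplies the integrability
    needed to pull the constant out. *)
Lemma normalized_integralE (h : 'cV[R]_2 -> R) :
  continuous (h \o conic_param D r) ->
  normalized_integral D r h =
  (2 * pi)^-1 * \int[mu]_(t in `[0, 2 * pi]) h (conic_param D r t).
Proof.
move=> ch; rewrite /normalized_integral /tau_integral /arc_length_integral.
under eq_Rintegral do rewrite -mulrA tau_density_speed.
have q0 : q != 0 by rewrite gt_eqF// sqrtr_gt0 ltr0n.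
have p0 : pi != 0 :> R by rewrite gt_eqF// pi_gt0.
rewrite RintegralZr//; last exact: (continuous_itv_integrable R _ _ _ ch).
set I := Rintegral _ _ _; move: I (@pi R) q p0 q0 => I p w p0 w0.
by case: (_ == 3)%N; field; rewrite p0.
Qed.

Lemma continuous_meval (n : nat) (v : R -> 'I_n -> R) (f : mpoly n R) :
  (forall i, continuous (v ^~ i)) -> continuous (fun t => meval (v t) f).
Proof.
move=> cv; elim/mpolyind: f => [|c m p _ _ IH] t.
  by under eq_fun do rewrite meval0; exact: cvg_cst.
under eq_fun do rewrite mevalD mevalZ mevalX.
apply: cvgD; last exact: IH.
apply: cvgM; first exact: cvg_cst.
apply: cvg_big => [|i _]; first exact: mul_continuous.
by apply: (@continuous_comp _ _ _ (v ^~ i) (fun y => y ^+ m i));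
  [exact: cv|exact: exprn_continuous].
Qed.

Lemma continuous_peval_param f : continuous (peval f \o conic_param D r).
Proof.
apply: continuous_meval => i.
under eq_fun do rewrite param_mxE mxE !big_ord_recl big_ord0 addr0 !mxE.
move=> t.
by apply: cvgD; (apply: cvgM; [exact: cvg_cst|]);
  [exact: continuous_cos|exact: continuous_sin].
Qed.

Lemma normalized_integralD f g :
  normalized_integral D r (peval (f + g)) =
  normalized_integral D r (peval f) + normalized_integral D r (peval g).
Proof.
rewrite !normalized_integralE; try exact: continuous_peval_param.
rewrite -mulrDr -RintegralD//.
- by congr (_ * _); apply: eq_Rintegral => t _; rewrite /peval mevalD.
- exact: (continuous_itv_integrable R _ _ _ (continuous_peval_param f)).
- exact: (continuous_itv_integrable R _ _ _ (continuous_peval_param g)).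
Qed.

(** The hypothesis concerns [invmx M] because that is the matrix moving the points. It changes the
    parameter to [s * t + c], harmless for an integrand of period [2 * pi]. *)
Lemma normalized_integral_act (M : 'M[R]_2) f :
  orthogonal_group (Qmx R D) (invmx M) ->
  normalized_integral D r (peval (poly_act M f)) =
  normalized_integral D r (peval f).
Proof.
move=> /(orthogonal_conic_param _ _ _ hD1 hr)[s [c [s2 cpi hM]]].
rewrite !normalized_integralE; try exact: continuous_peval_param.
congr (_ * _).
pose F t := peval f (conic_param D r t).
apply: etrans (Rintegral_periodic_isometry R F (2 * pi) s c _ _ _ s2 _).
- by apply: eq_Rintegral => t _; rewrite peval_poly_act hM.
- by rewrite mulr_gt0// pi_gt0.
- exact: continuous_peval_param.
- move=> t; rewrite /F !param_mxE (_ : 2 * pi = pi *+ 2) ?cosD2pi ?sinD2pi//.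
  by rewrite mulr_natl.
- by rewrite (le_trans cpi)// ler_peMl ?pi_ge0// ler1n.
Qed.

End NormalizedIntegral.

Theorem theorem3p2 (R : realType) (D : nat) (r : R) (n : nat)
    (G : {fset 'M[R]_2}) (X : {fset 'cV[R]_2})
    (hD1 : (1 <= D)%N) (hD : square_free D) (hr : 0 < r)
    (hG : is_subgroup G (orthogonal_group (Qmx R D)))
    (hX0 : X != fset0) (hX : [set` X] `<=` conic D r)
    (hGX : set_invariant G X) :
  ellipsoidal_design D r n X <->
  (forall f : mpoly 2 R, poly_invariant G f -> (msize f <= n.+1)%N ->
     average X (peval f) = normalized_integral D r (peval f)).
Proof.
split=> [design f _|design f degf]; first exact: design.
(* [L] measures the failure of the design identity. It is additive and takes the same value on all
   [poly_act M f] with [M] in [G]. *)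
pose L g := average X (peval g) - normalized_integral D r (peval g).
have LD : {morph L : g h / g + h}.
  move=> g h; rewrite /L normalized_integralD// opprD addrACA; congr (_ + _).
  rewrite /average -mulrDr -big_split/=; congr (_ * _).
  by apply: eq_bigr => v _; rewrite /peval mevalD.
have L0 : L 0 = 0 by apply: (addrI (L 0)); rewrite -LD !addr0.
have [sG oneG _ iG] := hG.
have LM M : M \in G -> L (poly_act M f) = L f.
  move=> MG; rewrite /L (average_peval_act _ _ _ hG)//.
  by rewrite normalized_integral_act//; exact/sG/iG.
(* The orbit sum is invariant and of degree at most [n], so condition (ii) applies to it. *)
have : L (\sum_(M <- G) poly_act M f) = 0.
  apply/eqP; rewrite subr_eq0; apply/eqP/design.
    exact: orbit_sum_invariant hG _.
  apply: (leq_trans (msize_sum _ _ _)); apply/bigmax_leqP_seq => M _ _.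
  exact: leq_trans (msize_poly_act _ _ _) degf.
(* By additivity this value is also [L f] times the order of [G], which is non-zero because [G]
   contains the identity. *)
rewrite (big_morph L LD L0) (eq_big_seq (fun=> L f))// => /eqP.
rewrite big_const_seq count_predT iter_addr_0 mulrn_eq0.
rewrite subr_eq0 => /orP[/eqP G0|/eqP//].
by move: oneG; rewrite (cardfs0_eq G0) inE.
Qed.
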